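(* Define linear maps $V\to V$ on basis elements $d$ by $$\Phi_{\mathrm{mono}\leftarrow\mathrm{mor}}(d)=\sum_{d'}\frac{|\mathrm{RegEpi}(d,d')|}{|\mathrm{Aut}(d')|}\,d',\qquad \Phi_{\mathrm{regmono}\leftarrow\mathrm{mor}}(d)=\sum_{d'}\frac{|\mathrm{Epi}(d,d')|}{|\mathrm{Aut}(d')|}\,d',$$ the sums running over all isomorphism classes $d'$ of finite strict double posets. Then both maps are linear isomorphisms. They are filtered, i.e. they map $\mathbb Q[\mathsf{DP}(n)]$ into $\bigoplus_{m\le n}\mathbb Q[\mathsf{DP}(m)]$. Moreover, if the domain of $\Phi_{\mathrm{regmono}\leftarrow\mathrm{mor}}$ is graded so that its degree-$n$ part is $\mathbb Q[\Phi_{\mathrm{regmono}\leftarrow\mathrm{mor}}^{-1}(\mathsf{DP}(n))]$, then $\Phi_{\mathrm{regmono}\leftarrow\mathrm{mor}}$ is graded; the analogous statement holds for $\Phi_{\mathrm{mono}\leftarrow\mathrm{mor}}$.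
   Context: A finite strict double poset is a triple $(A,P_A,Q_A)$ with $A$ finite and $P_A,Q_A\subseteq A\times A$ strict partial orders. Morphisms $(A,P_A,Q_A)\to(B,P_B,Q_B)$ are maps $f:A\to B$ with $(x,y)\in P_A\Rightarrow(f(x),f(y))\in P_B$ and $(x,y)\in Q_A\Rightarrow(f(x),f(y))\in Q_B$; this defines a category. $\mathrm{Epi}(d,d')$ is the set of epimorphisms, $\mathrm{RegEpi}(d,d')$ the set of regular epimorphisms (morphisms that are the coequalizer of some parallel pair of morphisms), $\mathrm{Aut}(d')$ the automorphism group; these cardinalities depend only on isomorphism classes. $\mathsf{DP}(n)$ is the set of isomorphism classes of double posets with $n$ elements and $V=\bigoplus_{n\ge0}\mathbb Q[\mathsf{DP}(n)]$ is the free $\mathbb Q$-vector space on all isomorphism classes. *)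

(* Defs.v *)
From HB Require Import structures.
From mathcomp Require Import all_boot all_order all_algebra.
From mathcomp Require Import finmap monalg.
From mathcomp Require Import boolp classical_sets functions cardinality fsbigop.

Set Implicit Arguments.
Unset Strict Implicit.
Unset Printing Implicit Defensive.

Import GRing.Theory Num.Theory.

Local Open Scope quotient_scope.
Local Open Scope ring_scope.

Definition strict_order (T : finType) (R : {set T * T}) : bool :=
  [forall x, (x, x) \notin R] &&
  [forall x, forall y, forall z,
     ((x, y) \in R) && ((y, z) \in R) ==> ((x, z) \in R)].

Record dposet : Type := DPoset {
  dcar :> finType;
  dP : {set dcar * dcar};
  dQ : {set dcar * dcar};
  dP_strict : strict_order dP;
  dQ_strict : strict_order dQ
}.

Definition is_dmor (A B : dposet) (f : {ffun A -> B}) : bool :=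
  [forall x, forall y, ((x, y) \in dP A) ==> ((f x, f y) \in dP B)] &&
  [forall x, forall y, ((x, y) \in dQ A) ==> ((f x, f y) \in dQ B)].

Definition dhom (A B : dposet) : finType := {f : {ffun A -> B} | is_dmor f}.

Definition DHom (A B : dposet) (f : {ffun A -> B}) (fP : is_dmor f) : dhom A B :=
  Sub f fP.

Lemma is_dmorP (A B : dposet) (f : {ffun A -> B}) :
  reflect ((forall x y, (x, y) \in dP A -> (f x, f y) \in dP B) /\
           (forall x y, (x, y) \in dQ A -> (f x, f y) \in dQ B))
          (is_dmor f).
Proof.
apply: (iffP andP) => -[hP hQ]; split.
- by move=> x y; apply/implyP; move/forallP/(_ x)/forallP/(_ y): hP.
- by move=> x y; apply/implyP; move/forallP/(_ x)/forallP/(_ y): hQ.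
- by apply/forallP => x; apply/forallP => y; apply/implyP; exact: hP.
- by apply/forallP => x; apply/forallP => y; apply/implyP; exact: hQ.
Qed.

Lemma strict_orderP (T : finType) (R : {set T * T}) :
  reflect ((forall x, (x, x) \notin R) /\
           (forall x y z, (x, y) \in R -> (y, z) \in R -> (x, z) \in R))
          (strict_order R).
Proof.
apply: (iffP andP) => -[hI hT]; split.
- by move=> x; move/forallP/(_ x): hI.
- move=> x y z xy yz.
  by move/forallP/(_ x)/forallP/(_ y)/forallP/(_ z)/implyP: hT => ->//; apply/andP.
- by apply/forallP.
- apply/forallP => x; apply/forallP => y; apply/forallP => z.
  by apply/implyP => /andP[]; exact: hT.
Qed.

Lemma did_subproof (A : dposet) : is_dmor [ffun x : A => x].
Proof. by apply/is_dmorP; split=> x y; rewrite !ffunE. Qed.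

Definition did (A : dposet) : dhom A A := DHom (did_subproof A).

Lemma dcomp_subproof (A B C : dposet) (g : dhom B C) (f : dhom A B) :
  is_dmor [ffun x : A => val g (val f x)].
Proof.
have /is_dmorP[gP gQ] := valP g; have /is_dmorP[fP fQ] := valP f.
by apply/is_dmorP; split=> x y xy; rewrite !ffunE; [apply/gP/fP|apply/gQ/fQ].
Qed.

Definition dcomp (A B C : dposet) (g : dhom B C) (f : dhom A B) : dhom A C :=
  DHom (dcomp_subproof g f).

Definition is_iso (A B : dposet) (f : dhom A B) : Prop :=
  exists g : dhom B A, dcomp g f = did A /\ dcomp f g = did B.

Definition is_epi (A B : dposet) (f : dhom A B) : Prop :=
  forall (C : dposet) (g h : dhom B C), dcomp g f = dcomp h f -> g = h.

Definition is_coequalizer (C A B : dposet) (u v : dhom C A) (f : dhom A B)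
  : Prop :=
  dcomp f u = dcomp f v /\
  forall (D : dposet) (g : dhom A D), dcomp g u = dcomp g v ->
    exists! k : dhom B D, dcomp k f = g.

Definition is_regepi (A B : dposet) (f : dhom A B) : Prop :=
  exists (C : dposet) (u v : dhom C A), is_coequalizer u v f.

Definition isomorphic (A B : dposet) : Prop := exists f : dhom A B, is_iso f.

Definition card_Epi (A B : dposet) : nat :=
  #|[pred f : dhom A B | `[< is_epi f >]]|.
Definition card_RegEpi (A B : dposet) : nat :=
  #|[pred f : dhom A B | `[< is_regepi f >]]|.
Definition card_Aut (A : dposet) : nat :=
  #|[pred f : dhom A A | `[< is_iso f >]]|.

Lemma dhom_ext (A B : dposet) (f g : dhom A B) : val f =1 val g -> f = g.
Proof. by move=> fg; apply: val_inj; apply/ffunP. Qed.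

Lemma dcompE (A B C : dposet) (g : dhom B C) (f : dhom A B) x :
  val (dcomp g f) x = val g (val f x).
Proof. by rewrite ffunE. Qed.

Lemma didE (A : dposet) x : val (did A) x = x.
Proof. by rewrite ffunE. Qed.

Lemma dcompA (A B C D : dposet) (h : dhom C D) (g : dhom B C) (f : dhom A B) :
  dcomp h (dcomp g f) = dcomp (dcomp h g) f.
Proof. by apply: dhom_ext => x; rewrite !dcompE. Qed.

Lemma dcomp1f (A B : dposet) (f : dhom A B) : dcomp (did B) f = f.
Proof. by apply: dhom_ext => x; rewrite dcompE didE. Qed.

Lemma dcompf1 (A B : dposet) (f : dhom A B) : dcomp f (did A) = f.
Proof. by apply: dhom_ext => x; rewrite dcompE didE. Qed.

Lemma isomorphic_refl A : isomorphic A A.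
Proof. by exists (did A), (did A); rewrite dcomp1f. Qed.

Lemma isomorphic_sym A B : isomorphic A B -> isomorphic B A.
Proof. by move=> [f [g [gf fg]]]; exists g, f. Qed.

Lemma isomorphic_trans A B C :
  isomorphic A B -> isomorphic B C -> isomorphic A C.
Proof.
move=> [f [f' [ff ff']]] [g [g' [gg gg']]]; exists (dcomp g f), (dcomp f' g').
split.
- by rewrite -dcompA (dcompA g') gg dcomp1f.
- by rewrite -dcompA (dcompA f) ff' dcomp1f.
Qed.

(* The type [dposet] is too large to carry a [choiceType] structure (its objects
   range over all finite types), so the quotient is taken on the double posets
   with carrier ['I_n]; [dclass], [dclassP] and [drepK] below identify it with
   the isomorphism classes of all finite double posets. *)
Definition sdposet : Type :=
  {n : nat & {R : {set 'I_n * 'I_n} * {set 'I_n * 'I_n}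
             | strict_order R.1 && strict_order R.2}}.
HB.instance Definition _ := Choice.on sdposet.

Definition sdposet_dposet (d : sdposet) : dposet :=
  DPoset (proj1 (andP (valP (tagged d)))) (proj2 (andP (valP (tagged d)))).

Definition sdposet_iso (d e : sdposet) : bool :=
  `[< isomorphic (sdposet_dposet d) (sdposet_dposet e) >].

Lemma sdposet_iso_equiv : equiv_class_of sdposet_iso.
Proof.
split=> [d|d e|e d f].
- exact/asboolP/isomorphic_refl.
- by apply/asboolP/asboolP; exact: isomorphic_sym.
- by move=> /asboolP h /asboolP k; apply/asboolP; exact: isomorphic_trans h k.
Qed.

Canonical sdposet_equiv : equiv_rel sdposet :=
  EquivRelPack sdposet_iso_equiv.

Definition DP : Type := {eq_quot sdposet_equiv}.
HB.instance Definition _ := Choice.on DP.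

Definition dpi (s : sdposet) : DP := \pi_{eq_quot sdposet_equiv} s.

Definition drep (d : DP) : dposet :=
  sdposet_dposet (repr (d : {eq_quot sdposet_equiv})).

Definition dsize (d : DP) : nat := #|drep d|.

Definition prerel (S T : finType) (f : S -> T) (R : {set T * T}) : {set S * S} :=
  [set p | (f p.1, f p.2) \in R].

Lemma prerel_strict (S T : finType) (f : S -> T) (R : {set T * T}) :
  strict_order R -> strict_order (prerel f R).
Proof.
move=> /strict_orderP[hI hT]; apply/strict_orderP; split=> [x|x y z].
  by rewrite inE /= hI.
by rewrite !inE /=; exact: hT.
Qed.

Lemma dstd_subproof (A : dposet) :
  strict_order (prerel (@enum_val A A) (dP A)) &&
  strict_order (prerel (@enum_val A A) (dQ A)).
Proof. by rewrite !prerel_strict ?dP_strict ?dQ_strict. Qed.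

Definition dstd (A : dposet) : sdposet :=
  existT _ #|A| (exist _ (prerel (@enum_val A A) (dP A),
                          prerel (@enum_val A A) (dQ A)) (dstd_subproof A)).

Definition dclass (A : dposet) : DP := dpi (dstd A).

Lemma dstd_iso A : isomorphic (sdposet_dposet (dstd A)) A.
Proof.
have hf : @is_dmor (sdposet_dposet (dstd A)) A
    [ffun x : 'I_#|A| => @enum_val A A x].
  by apply/is_dmorP; split=> x y /=; rewrite inE !ffunE.
have hg : @is_dmor A (sdposet_dposet (dstd A))
    [ffun x : A => enum_rank x : 'I_#|A|].
  by apply/is_dmorP; split=> x y /= xy; rewrite inE !ffunE /= !enum_rankK.
exists (DHom hf), (DHom hg); split; apply: dhom_ext => x;
  by rewrite dcompE didE /= !ffunE ?enum_valK ?enum_rankK.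
Qed.

Lemma dpiP s t : dpi s = dpi t <->
  isomorphic (sdposet_dposet s) (sdposet_dposet t).
Proof. by split=> [/eqmodP/asboolP|st] //; apply/eqmodP/asboolP. Qed.

Lemma dpi_repr (d : DP) : dpi (repr (d : {eq_quot sdposet_equiv})) = d.
Proof. exact: reprK. Qed.

Lemma drepK d : dclass (drep d) = d.
Proof. by rewrite -[RHS]dpi_repr; apply/dpiP; exact: dstd_iso. Qed.

Lemma drep_dclass A : isomorphic (drep (dclass A)) A.
Proof. by apply: (isomorphic_trans _ (dstd_iso A)); apply/dpiP/dpi_repr. Qed.

Lemma dclassP A B : dclass A = dclass B <-> isomorphic A B.
Proof.
split=> [AB|AB].
  apply: (isomorphic_trans (isomorphic_sym (drep_dclass A))).
  by rewrite AB; exact: drep_dclass.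
apply/dpiP/(isomorphic_trans (dstd_iso A))/(isomorphic_trans AB).
exact/isomorphic_sym/dstd_iso.
Qed.

Lemma iso_epi A B (f : dhom A B) : is_iso f -> is_epi f.
Proof.
move=> [k [kf fk]] C g h gh.
by rewrite -(dcompf1 g) -(dcompf1 h) -fk !dcompA gh.
Qed.

Lemma epi_comp A B C (g : dhom B C) (f : dhom A B) :
  is_epi g -> is_epi f -> is_epi (dcomp g f).
Proof. by move=> eg ef D h k; rewrite !dcompA => /ef /eg. Qed.

Lemma regepi_epi A B (f : dhom A B) : is_regepi f -> is_epi f.
Proof.
move=> [C [u [v [fuv coeq]]]] D g h gh.
have [|k [_ uk]] := coeq D (dcomp g f); first by rewrite -!dcompA fuv.
by rewrite -(uk g) // -(uk h).
Qed.

Lemma regepi_isol A B B' (f : dhom A B) (s : dhom B B') :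
  is_iso s -> is_regepi f -> is_regepi (dcomp s f).
Proof.
move=> [t [ts st]] [C [u [v [fuv coeq]]]]; exists C, u, v; split.
  by rewrite -!dcompA fuv.
move=> D g /coeq[k [kf uk]]; exists (dcomp k t); split.
  by rewrite -dcompA (dcompA t) ts dcomp1f.
move=> k' k'g; rewrite (uk (dcomp k' s)) -?dcompA ?st ?dcompf1 //.
Qed.

Lemma regepi_isor A A' B (f : dhom A B) (s : dhom A' A) :
  is_iso s -> is_regepi f -> is_regepi (dcomp f s).
Proof.
move=> [t [ts st]] [C [u [v [fuv coeq]]]].
exists C, (dcomp t u), (dcomp t v); split.
  by rewrite -!dcompA !(dcompA s) st !dcomp1f.
move=> D g; rewrite !dcompA => /coeq[k [kf uk]]; exists k; split.
  by rewrite dcompA kf -dcompA ts dcompf1.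
by move=> k' k'g; apply: uk; rewrite -k'g -!dcompA st dcompf1.
Qed.

Lemma card_dhom_iso (E : forall A B, dhom A B -> Prop) :
  (forall A B B' (f : dhom A B) (s : dhom B B'),
     is_iso s -> E _ _ f -> E _ _ (dcomp s f)) ->
  (forall A A' B (f : dhom A B) (s : dhom A' A),
     is_iso s -> E _ _ f -> E _ _ (dcomp f s)) ->
  forall A A' B B', isomorphic A A' -> isomorphic B B' ->
  #|[pred f : dhom A B | `[< E _ _ f >]]| =
  #|[pred f : dhom A' B' | `[< E _ _ f >]]|.
Proof.
move=> El Er.
have le A A' B B' : isomorphic A A' -> isomorphic B B' ->
    (#|[pred f : dhom A B | `[< E _ _ f >]]| <=
     #|[pred f : dhom A' B' | `[< E _ _ f >]]|)%N.
  move=> [s [t [ts st]]] [p [q [qp pq]]].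
  pose F (f : dhom A B) := dcomp p (dcomp f t).
  have Finj : injective F.
    apply: (can_inj (g := fun h => dcomp q (dcomp h s))) => f.
    by rewrite /F -!dcompA ts dcompf1 dcompA qp dcomp1f.
  rewrite -(fintype.card_image Finj); apply: subset_leq_card.
  apply/fintype.subsetP => h.
  move=> /fintype.imageP[f]; rewrite !inE => Ef ->.
  by rewrite /F; apply: El; [exists q|apply: Er => //; exists s].
move=> A A' B B' hA hB; apply/eqP.
by rewrite eqn_leq !le //; exact: isomorphic_sym.
Qed.

Lemma card_Epi_iso A A' B B' : isomorphic A A' -> isomorphic B B' ->
  card_Epi A B = card_Epi A' B'.
Proof.
apply: (@card_dhom_iso is_epi) => *.
- by apply: epi_comp => //; exact: iso_epi.
- by apply: epi_comp => //; exact: iso_epi.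
Qed.

Lemma card_RegEpi_iso A A' B B' : isomorphic A A' -> isomorphic B B' ->
  card_RegEpi A B = card_RegEpi A' B'.
Proof.
apply: (@card_dhom_iso is_regepi) => *.
- exact: regepi_isol.
- exact: regepi_isor.
Qed.

Lemma iso_comp A B C (g : dhom B C) (f : dhom A B) :
  is_iso g -> is_iso f -> is_iso (dcomp g f).
Proof.
move=> [g' [gg gg']] [f' [ff ff']]; exists (dcomp f' g'); split.
- by rewrite -dcompA (dcompA g') gg dcomp1f.
- by rewrite -dcompA (dcompA f) ff' dcomp1f.
Qed.

Lemma card_Aut_iso A B : isomorphic A B -> card_Aut A = card_Aut B.
Proof.
by move=> AB; apply: (@card_dhom_iso is_iso) => // *; exact: iso_comp.
Qed.

Lemma epi_surj A B (f : dhom A B) : is_epi f -> forall b, exists a, val f a = b.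
Proof.
move=> ef b; apply: contrapT => nb.
pose p (x : option B) : B := odflt b x.
pose C := DPoset (prerel_strict p (dP_strict B)) (prerel_strict p (dQ_strict B)).
have hg : @is_dmor B C [ffun x : B => Some x : C].
  by apply/is_dmorP; split=> x y xy /=; rewrite inE !ffunE.
have hh : @is_dmor B C [ffun x : B => (if x == b then None else Some x) : C].
  have pE x : p (if x == b then None else Some x) = x.
    by case: eqP => [->|].
  by apply/is_dmorP; split=> x y xy /=; rewrite inE !ffunE /= !pE.
have := ef C (DHom hg) (DHom hh).
have -> : dcomp (DHom hg) f = dcomp (DHom hh) f.
  apply: dhom_ext => x; rewrite !dcompE /= !ffunE.
  by case: eqP => // fx; case: nb; exists x.
by move=> /(_ erefl)/(congr1 (fun k : dhom B C => val k b)) /=; rewrite !ffunE eqxx.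
Qed.

Lemma epi_card A B (f : dhom A B) : is_epi f -> (#|B| <= #|A|)%N.
Proof.
move=> /epi_surj fs; rewrite -cardsT -(cardsT A).
have -> : [set: B] = [set val f x | x in [set: A]]%SET.
  apply/setP => b; rewrite inE; apply/esym/imsetP.
  by have [a <-] := fs b; exists a; rewrite ?inE.
exact: leq_imset_card.
Qed.

Local Open Scope classical_set_scope.

Lemma finite_dsize N : finite_set [set d : DP | (dsize d <= N)%N].
Proof.
pose T := {n : 'I_N.+1 & {R : {set 'I_n * 'I_n} * {set 'I_n * 'I_n}
             | strict_order R.1 && strict_order R.2}}.
pose F (t : T) : DP := dpi (existT _ (tag t : nat) (tagged t)).
apply: (@sub_finite_set _ _ (F @` [set: T])); last first.
  by apply: finite_image; exact: finite_finset.
move=> d /=; rewrite /dsize /drep => hd.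
case E : (repr d) hd => [n r] /=; rewrite card_ord => nN.
exists (existT _ (Ordinal (nN : (n < N.+1)%N)) r) => //.
by rewrite /F /= -[RHS]dpi_repr E.
Qed.

Notation V := {malg rat[DP]}.

Definition dvec (d : DP) : V := << d >>.

Definition Phi_mono_mor_basis (d : DP) : V :=
  \sum_(d' \in [set: DP])
    ((card_RegEpi (drep d) (drep d'))%:R / (card_Aut (drep d'))%:R) *: dvec d'.

Definition Phi_regmono_mor_basis (d : DP) : V :=
  \sum_(d' \in [set: DP])
    ((card_Epi (drep d) (drep d'))%:R / (card_Aut (drep d'))%:R) *: dvec d'.

Definition lin_ext (F : DP -> V) (v : V) : V :=
  \sum_(d <- msupp v) v@_d *: F d.

Definition Phi_mono_mor : V -> V := lin_ext Phi_mono_mor_basis.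
Definition Phi_regmono_mor : V -> V := lin_ext Phi_regmono_mor_basis.

(* The sums over all isomorphism classes have finite support, so the convention
   that [\sum_(_ \in _)] is 0 on an infinite support plays no role. *)
Lemma card_Epi_finite d :
  finite_set [set d' | card_Epi (drep d) (drep d') <> 0%N].
Proof.
apply: sub_finite_set (finite_dsize (dsize d)) => d' /= /eqP.
by rewrite -lt0n => /card_gt0P[f]; rewrite inE => /epi_card.
Qed.

Lemma card_RegEpi_finite d :
  finite_set [set d' | card_RegEpi (drep d) (drep d') <> 0%N].
Proof.
apply: sub_finite_set (finite_dsize (dsize d)) => d' /= /eqP.
by rewrite -lt0n => /card_gt0P[f]; rewrite inE => /regepi_epi/epi_card.
Qed.

Lemma lin_extU F d : lin_ext F (dvec d) = F d.
Proof.
rewrite /lin_ext /dvec msuppU oner_eq0 big_seq_fset1.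
by rewrite mcoeffU eqxx scale1r.
Qed.

Lemma Phi_mono_morE A : Phi_mono_mor (dvec (dclass A)) =
  \sum_(d' \in [set: DP])
    ((card_RegEpi A (drep d'))%:R / (card_Aut (drep d'))%:R) *: dvec d'.
Proof.
rewrite /Phi_mono_mor lin_extU; apply: eq_fsbigr => d' _.
by rewrite (card_RegEpi_iso (drep_dclass A) (isomorphic_refl _)).
Qed.

Lemma Phi_regmono_morE A : Phi_regmono_mor (dvec (dclass A)) =
  \sum_(d' \in [set: DP])
    ((card_Epi A (drep d'))%:R / (card_Aut (drep d'))%:R) *: dvec d'.
Proof.
rewrite /Phi_regmono_mor lin_extU; apply: eq_fsbigr => d' _.
by rewrite (card_Epi_iso (drep_dclass A) (isomorphic_refl _)).
Qed.

Definition lspan (S : set V) : set V :=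
  [set v | exists (k : nat) (c : 'I_k -> rat) (s : 'I_k -> V),
     (forall i, S (s i)) /\ v = \sum_(i < k) c i *: s i].

(* [DPn n] is the set of isomorphism classes with [n] elements, seen as basis
   vectors of [V]. *)
Definition DPn (n : nat) : set V := [set dvec d | d in [set d | dsize d = n]].

Definition QDP (n : nat) : set V := lspan (DPn n).

Definition QDP_le (n : nat) : set V :=
  [set v | exists f : 'I_n.+1 -> V,
     (forall m : 'I_n.+1, QDP m (f m)) /\ v = \sum_(m < n.+1) f m].

Definition linear_isomorphism (f : V -> V) : Prop := linear f /\ bijective f.

Definition filtered (f : V -> V) : Prop :=
  forall n, f @` QDP n `<=` QDP_le n.

Definition is_subspace (W : set V) : Prop :=
  W 0 /\ forall (a : rat) u v, W u -> W v -> W (a *: u + v).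

(* [V] is the internal direct sum of the subspaces [W n]. *)
Definition is_grading (W : nat -> set V) : Prop :=
  (forall n, is_subspace (W n)) /\
  forall v, exists! f : nat -> V,
    [/\ forall n, W n (f n), finite_set [set n | f n <> 0]
      & v = \sum_(n \in [set: nat]) f n].

Definition graded (W W' : nat -> set V) (f : V -> V) : Prop :=
  [/\ is_grading W, is_grading W' & forall n, f @` W n `<=` W' n].

(* Main.v *)
(** Both maps are unitriangular for a rank on isomorphism classes.  An
    epimorphism [f : A -> B] of double posets is surjective, so it does not
    increase the number of elements, nor the number of pairs outside [P], nor
    the number of pairs outside [Q].  If the sum of these three numbers is
    preserved, then [f] is a bijection that reflects both orders, i.e. an
    isomorphism.  Hence every class [d' <> d] occurring in the image of [d] has
    smaller rank, and the coefficient of [d] itself is [|Aut d| / |Aut d| = 1].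
    The grading of the domain is the pullback of the grading by size along the
    resulting linear isomorphism. *)
From HB Require Import structures.
Require Import Defs.
From mathcomp Require Import all_boot all_order all_algebra.
From mathcomp Require Import finmap monalg.
From mathcomp Require Import boolp classical_sets functions cardinality fsbigop.

Set Implicit Arguments.
Unset Strict Implicit.
Unset Printing Implicit Defensive.

Import GRing.Theory Num.Theory.

Local Open Scope ring_scope.

(** * Complements of the orders and the rank *)

Section Rank.

Definition corel (T : finType) (R : {set T * T}) : {set T * T} := finset.setC R.

Definition drank (A : dposet) : nat :=
  (#|A| + (#|corel (dP A)| + #|corel (dQ A)|))%N.

Variables (A B : finType) (f : A -> B).
Variables (R : {set A * A}) (S : {set B * B}).
Hypothesis f_surj : forall b, exists a, f a = b.
Hypothesis f_hom : forall x y, (x, y) \in R -> (f x, f y) \in S.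

Let ff (p : A * A) : B * B := (f p.1, f p.2).

(** Surjectivity gives preimages of both entries of a pair outside [S]; since [f] preserves the
    relations, these preimages form a pair outside [R]. *)
Lemma corel_sub_imset : (corel S \subset ff @: corel R)%SET.
Proof.
apply/fintype.subsetP => -[u v]; have [x <-] := f_surj u; have [y <-] := f_surj v.
rewrite !inE => nS; apply/imsetP; exists (x, y) => //.
by rewrite !inE; apply: contra nS; exact: f_hom.
Qed.

Lemma corel_le : (#|corel S| <= #|corel R|)%N.
Proof.
exact: leq_trans (subset_leq_card corel_sub_imset) (leq_imset_card _ _).
Qed.

(** Equal cardinalities turn the inclusion of [corel_sub_imset] into an equality, so [ff] sends
    pairs outside [R] to pairs outside [S]; reflection is the contrapositive. *)
Lemma corel_eq_reflect : #|corel R| = #|corel S| ->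
  forall x y, (f x, f y) \in S -> (x, y) \in R.
Proof.
move=> cRS x y; apply: contraLR => nR.
have eS : corel S = imset ff (mem (corel R)).
  by apply/eqP; rewrite eqEcard corel_sub_imset -cRS leq_imset_card.
have : ff (x, y) \in corel S by rewrite eS imset_f // !inE.
by rewrite !inE.
Qed.

End Rank.

Lemma surj_card_inj (A B : finType) (f : A -> B) :
  (forall b, exists a, f a = b) -> #|A| = #|B| -> injective f.
Proof.
move=> fs AB; apply/injectiveP/card_uniqP; rewrite size_map -cardE AB.
by apply: eq_card => b; have [a <-] := fs b; rewrite [RHS]inE codom_f.
Qed.

Lemma epi_drank A B (f : dhom A B) : is_epi f -> (drank B <= drank A)%N.
Proof.
move=> ef; have /is_dmorP[fP fQ] := valP f.
have fs := epi_surj ef.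
by rewrite !leq_add // ?(epi_card ef) ?(corel_le fs fP) ?(corel_le fs fQ).
Qed.

Lemma epi_drank_iso A B (f : dhom A B) :
  is_epi f -> drank A = drank B -> is_iso f.
Proof.
move=> ef eR; have /is_dmorP[fP fQ] := valP f; have fs := epi_surj ef.
have cA := epi_card ef; have cP := corel_le fs fP; have cQ := corel_le fs fQ.
have [eA eP eQ] :
    [/\ #|A| = #|B|, #|corel (dP A)| = #|corel (dP B)|
      & #|corel (dQ A)| = #|corel (dQ B)|].
  (* Three inequalities whose sum is an equality are each equalities. *)
  move/eqP: eR; rewrite /drank eq_sym (leqif_add (leqif_eq cA)
    (leqif_add (leqif_eq cP) (leqif_eq cQ))).
  by move=> /and3P[/eqP-> /eqP-> /eqP->].
have rP := corel_eq_reflect fs fP eP; have rQ := corel_eq_reflect fs fQ eQ.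
have fi := surj_card_inj fs eA.
have [g fK gK] := inj_card_bij fi (eq_leq (esym eA)).
have hg : is_dmor [ffun x => g x].
  by apply/is_dmorP; split=> x y xy; rewrite !ffunE; [apply: rP|apply: rQ];
    rewrite !gK.
by exists (DHom hg); split; apply: dhom_ext => x; rewrite dcompE didE /= ffunE.
Qed.

Lemma iso_regepi A B (f : dhom A B) : is_iso f -> is_regepi f.
Proof.
(* An isomorphism is the coequalizer of the identity with itself. *)
move=> [g [gf fg]]; exists A, (did A), (did A); split=> // D h _.
exists (dcomp h g); split; first by rewrite -dcompA gf dcompf1.
by move=> k <-; rewrite -dcompA fg dcompf1.
Qed.

Lemma card_Aut_gt0 A : (0 < card_Aut A)%N.
Proof.
apply/card_gt0P; exists (did A); rewrite inE.
by exists (did A); rewrite dcomp1f.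
Qed.

(** * Coefficients and linear extension *)

Local Notation V := {malg rat[DP]}.

Lemma dvecE (d k : DP) : (dvec d)@_k = (d == k)%:R.
Proof. by rewrite /dvec mcoeffU. Qed.

Lemma dvec_sum (v : V) : v = \sum_(d <- msupp v) v@_d *: dvec d.
Proof.
rewrite {1}[v]monalgE; apply: eq_bigr => d _; apply/malgP => k.
by rewrite mcoeffZ dvecE mcoeffU mulr_natr.
Qed.

(** Sums over the supports of different vectors can thus be compared over one common index set,
    which is how linearity is proved. *)
Lemma lin_ext_widen (F : DP -> V) (E : {fset DP}) (v : V) :
  (msupp v `<=` E)%fset -> lin_ext F v = \sum_(d <- E) v@_d *: F d.
Proof.
move=> sE; apply: big_fset_incl => // d _ /mcoeff_outdom ->.
by rewrite scale0r.
Qed.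

Lemma lin_ext_linear (F : DP -> V) : linear (lin_ext F).
Proof.
move=> a u v; pose E := (msupp u `|` msupp v `|` msupp (a *: u + v)%R)%fset.
rewrite !(@lin_ext_widen F E) ?/E.
- rewrite scaler_sumr -big_split /=; apply: eq_bigr => d _.
  by rewrite mcoeffD mcoeffZ scalerDl scalerA.
- by rewrite -fsetUA fsetUCA fsubsetUl.
- by rewrite -fsetUA fsubsetUl.
- by rewrite fsubsetUr.
Qed.

HB.instance Definition _ (F : DP -> V) :=
  GRing.isLinear.Build rat V V *:%R (lin_ext F) (lin_ext_linear F).

Lemma mcoeff_lin_ext (F : DP -> V) v k :
  (lin_ext F v)@_k = \sum_(d <- msupp v) v@_d * (F d)@_k.
Proof. by rewrite raddf_sum; apply: eq_bigr => d _; exact: mcoeffZ. Qed.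

Lemma inj_surj_bij (S T : Type) (f : S -> T) :
  injective f -> (forall y, exists x, f x = y) -> bijective f.
Proof.
move=> fi fs; pose g y := projT1 (cid (fs y)).
have gK : cancel g f by move=> y; rewrite /g; case: cid.
by exists g => // x; apply: fi; rewrite gK.
Qed.

(** * Unitriangular linear maps *)

Section Unitriangular.

Variables (F : DP -> V) (rk : DP -> nat).
Hypothesis F_diag : forall d, (F d)@_d = 1.
Hypothesis F_tri : forall d e, (F d)@_e != 0 -> e = d \/ (rk e < rk d)%N.

Lemma unitriangular_inj : injective (lin_ext F).
Proof.
apply: raddf_inj => v fv0; apply/eqP; apply: contraT => v0.
have /fset0Pn[d0 d0v] : msupp v != fset0.
  by apply: contraNneq v0 => sv; rewrite [v]dvec_sum sv big_seq_fset0.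
(* Take [d] of maximal rank in the support of a kernel element [v]. No other [e] in the support
   contributes to the coefficient at [d], which is therefore [v@_d], a nonzero number. *)
have [[d dv] _ dmax] :=
  @arg_maxnP (msupp v) [` d0v]%fset predT (fun x => rk (val x)) isT.
have := mcoeff_lin_ext F v d; rewrite fv0 mcoeff0.
rewrite (big_fsetD1 d) //= F_diag mulr1 big_seq big1 ?addr0.
  by move/esym/eqP; rewrite mcoeff_eq0 dv.
move=> e; rewrite in_fsetD1 => /andP[ed ev].
have [->|/F_tri[de|lt]] := eqVneq (F e)@_d 0; first exact: mulr0.
  by rewrite de eqxx in ed.
by have := dmax [` ev]%fset isT; rewrite /= leqNgt lt.
Qed.

Lemma unitriangular_surj v : exists u, lin_ext F u = v.
Proof.
have sumP (r : seq DP) (c : DP -> rat) (G : DP -> V) :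
    (forall d, d \in r -> exists u, lin_ext F u = G d) ->
    exists u, lin_ext F u = \sum_(d <- r) c d *: G d.
  elim: r => [|d r IH] Gr; first by exists 0; rewrite raddf0 big_nil.
  have [u uE] := Gr d (mem_head _ _).
  have [|w wE] := IH; first by move=> e er; apply: Gr; rewrite inE er orbT.
  by exists (c d *: u + w); rewrite linearP /= uE wE big_cons.
rewrite [v]dvec_sum; apply: (sumP) => d _.
(* Strong induction on the rank: [F d - dvec d] is supported in ranks below [rk d], so it has a
   preimage [w], and [dvec d - w] is mapped to [dvec d]. *)
have [n] := ubnP (rk d); elim: n d => // n IH d rd.
have [|w wE] := sumP (msupp (F d - dvec d)%R)
    (fun e => (F d - dvec d)@_e) (fun e => dvec e).
  move=> e; rewrite -mcoeff_neq0 mcoeffB dvecE => Fde.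
  apply: IH; have [de|de] := eqVneq d e.
    by rewrite -de F_diag eqxx subrr eqxx in Fde.
  rewrite (negPf de) subr0 in Fde; case: (F_tri Fde) => [ed|lt].
    by rewrite ed eqxx in de.
  exact: leq_trans lt rd.
exists (dvec d - w); rewrite raddfB /= wE -dvec_sum lin_extU.
by rewrite opprB addrC subrK.
Qed.

Lemma unitriangular_iso : linear_isomorphism (lin_ext F).
Proof.
split; first exact: lin_ext_linear.
exact: inj_surj_bij unitriangular_inj unitriangular_surj.
Qed.

End Unitriangular.

Local Open Scope classical_set_scope.

(** * Spans and the grading by size *)

Lemma lspan_subspace (S : set V) : is_subspace (lspan S).
Proof.
split.
  by exists 0%N, (fun=> 0), (fun=> 0); split=> [[]//|]; rewrite big_ord0.
move=> a u v [k [c [s [Ss ->]]]] [l [c' [s' [Ss' ->]]]].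
exists (k + l)%N,
  (fun i => match fintype.split i with inl j => a * c j | inr j => c' j end),
  (fun i => match fintype.split i with inl j => s j | inr j => s' j end).
split; first by move=> i; case: fintype.split => j.
rewrite big_split_ord /= scaler_sumr; congr (_ + _); apply: eq_bigr => i _.
  by rewrite (unsplitK (inl i)) scalerA.
by rewrite (unsplitK (inr i)).
Qed.

Lemma lspan_sum (S : set V) (I : eqType) (r : seq I) (c : I -> rat)
    (s : I -> V) :
  (forall i, i \in r -> S (s i)) -> lspan S (\sum_(i <- r) c i *: s i).
Proof.
move=> Sr; exists (size r), (fun i => c (tnth (in_tuple r) i)),
  (fun i => s (tnth (in_tuple r) i)); split.
  by move=> i; apply: Sr; rewrite mem_tnth.
by rewrite big_tnth.
Qed.

(** Turns membership in a span into a condition on the support, so that later arguments can work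
    coefficientwise. *)
Lemma QDPP n v : QDP n v <-> forall d, v@_d != 0 -> dsize d = n.
Proof.
split=> [[k [c [s [Ss ->]]]] d|vn].
  rewrite raddf_sum /=; apply: contraNeq => dn; apply/eqP/big1 => i _.
  rewrite mcoeffZ; have [e en <-] := Ss i; rewrite dvecE.
  by case: eqP => [ed|]; rewrite ?mulr0 //; rewrite -ed en eqxx in dn.
rewrite [v]dvec_sum; apply: lspan_sum => d; rewrite -mcoeff_neq0 => /vn dn.
by exists d.
Qed.

(** The projection of [V] onto its component of degree [n]. *)
Definition hcomp (n : nat) (v : V) : V :=
  lin_ext (fun d => (dsize d == n)%:R *: dvec d) v.

Lemma mcoeff_hcomp n v k : (hcomp n v)@_k = (dsize k == n)%:R * v@_k.
Proof.
rewrite mcoeff_lin_ext {3}[v]dvec_sum raddf_sum mulr_sumr.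
apply: eq_bigr => d _; rewrite /= !mcoeffZ dvecE.
by have [->|_] := eqVneq d k; rewrite ?mulr0 // !mulr1 mulrC.
Qed.

Lemma hcomp_QDP n v : QDP n (hcomp n v).
Proof.
apply/QDPP => d; rewrite mcoeff_hcomp; have [//|_] := eqVneq (dsize d) n.
by rewrite mul0r eqxx.
Qed.

Lemma QDP_leP n v : (forall d, v@_d != 0 -> (dsize d <= n)%N) -> QDP_le n v.
Proof.
move=> vn; exists (fun m => hcomp m v); split=> [m|]; first exact: hcomp_QDP.
apply/malgP => k; rewrite raddf_sum /=.
under eq_bigr do rewrite mcoeff_hcomp.
rewrite -mulr_suml; have [->|/vn kn] := eqVneq v@_k 0; first by rewrite mulr0.
rewrite (bigD1 (Ordinal (kn : (dsize k < n.+1)%N))) //= eqxx.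
rewrite big1 ?addr0 ?mul1r //.
by move=> m; rewrite -val_eqE eq_sym /= => /negPf->.
Qed.

(** Finiteness matters: the sum is 0 by convention when the support of [h] is infinite, whereas [f]
    might kill all but finitely many terms. *)
Lemma raddf_fsum (U W : zmodType) (f : {additive U -> W}) (h : nat -> U) :
  finite_set [set n | h n <> 0] ->
  f (\sum_(n \in [set: nat]) h n) = \sum_(n \in [set: nat]) f (h n).
Proof.
move=> fin; pose D := fset_set [set n | h n <> 0].
have h0 i : i \notin D -> h i = 0.
  by rewrite in_fset_set // => /negP; rewrite inE /= => /contrapT.
rewrite (fsbigTE _ _ h0) raddf_sum (fsbigTE D) //.
by move=> i /h0 ->; rewrite raddf0.
Qed.

Lemma QDP_grading : is_grading QDP.
Proof.
split=> [n|v]; first exact: lspan_subspace.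
(* Only the term of index [dsize k] can involve the class [k]. This determines each component by its
   coefficients and yields uniqueness. *)
have pick (f : nat -> V) k : (forall n, QDP n (f n)) ->
    \sum_(n \in [set: nat]) (f n)@_k = (f (dsize k))@_k.
  move=> fQ; rewrite (fsbigTE [fset (dsize k)]%fset) ?big_seq_fset1 //.
  move=> i; rewrite in_fset1; apply: contraNeq => fk.
  by rewrite ((QDPP _ _).1 (fQ i) _ fk).
(* A nonzero component occurs only in a degree that is the size of some class in the support of
   [v]. *)
have fin : finite_set [set n | hcomp n v <> 0].
  apply: (@sub_finite_set _ _ (dsize @` [set` msupp v])).
    move=> n /= hn; apply: contrapT => nn; apply: hn; apply/malgP => k.
    rewrite mcoeff_hcomp mcoeff0; have [kn|] := eqVneq (dsize k) n; last by rewrite mul0r.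
    have [->|] := eqVneq v@_k 0; first by rewrite mulr0.
    by rewrite mcoeff_neq0 => kv; case: nn; exists k.
  by apply: finite_image; exact: finite_fset.
exists (fun n => hcomp n v); split.
  split=> //; first by move=> n; exact: hcomp_QDP.
  apply/malgP => k; rewrite raddf_fsum // pick ?mcoeff_hcomp ?eqxx ?mul1r //.
  by move=> n; exact: hcomp_QDP.
move=> g [gQ gfin vE]; apply/funext => n; apply/malgP => k.
rewrite mcoeff_hcomp vE raddf_fsum // pick //.
have [->|kn] := eqVneq (dsize k) n; first by rewrite mul1r.
rewrite mul0r; apply/esym; apply: contraNeq kn => gk.
by rewrite ((QDPP _ _).1 (gQ n) _ gk).
Qed.

(** * Pullback of a grading along a linear bijection *)

Section Pullback.

Variable f : {linear V -> V}.
Hypothesis f_bij : bijective f.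

Lemma lspan_preimage (S : set V) : lspan (f @^-1` S) = f @^-1` lspan S.
Proof.
have [g fK gK] := f_bij.
apply/seteqP; split=> v /= [k [c [s [Ss vE]]]].
  exists k, c, (f \o s); split=> //; rewrite vE linear_sum.
  by apply: eq_bigr => i _; rewrite linearZ.
exists k, c, (g \o s); split=> [i /=|]; first by rewrite gK.
apply: (bij_inj f_bij); rewrite vE linear_sum.
by apply: eq_bigr => i _; rewrite linearZ /= gK.
Qed.

(** The components of [v] are the images under the inverse [g] of those of [f v]; applying [f] to
    any other decomposition reduces uniqueness to that for [W]. *)
Lemma grading_preimage (W : nat -> set V) :
  is_grading W -> is_grading (fun n => f @^-1` W n).
Proof.
move=> [Wsub Wsum]; have [g fK gK] := f_bij.
have f_eq0 v : f v = 0 <-> v = 0.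
  by split=> [fv0|->]; [apply: (bij_inj f_bij); rewrite fv0|]; rewrite raddf0.
split=> [n|v].
  split=> [/=|a u v Wu Wv /=]; first by rewrite raddf0; exact: (Wsub n).1.
  by rewrite linearP; exact: (Wsub n).2.
have finE (h : nat -> V) : [set n | f (h n) <> 0] = [set n | h n <> 0].
  by apply/seteqP; split=> n /=; apply: contra_not => /f_eq0.
have [w [[Ww wfin fvE] wU]] := Wsum (f v).
have wE : w = f \o (g \o w) by apply/funext => n /=; rewrite gK.
have gfin : finite_set [set n | (g \o w) n <> 0].
  by rewrite -finE -[X in [set n | X n <> 0]]wE.
exists (g \o w); split.
  split=> // [n /=|]; first by rewrite gK.
  apply: (bij_inj f_bij); rewrite fvE raddf_fsum //.
  by apply: eq_fsbigr => n _ /=; rewrite gK.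
move=> h [Wh hfin vE]; apply/funext => n /=.
rewrite (wU (f \o h)) /= ?fK //; split=> //; first by rewrite finE.
by rewrite vE raddf_fsum.
Qed.

Lemma graded_preimage (S : nat -> set V) :
  is_grading (fun n => lspan (S n)) ->
  graded (fun n => lspan (f @^-1` S n)) (fun n => lspan (S n)) f.
Proof.
move=> gS.
have eW : (fun n => lspan (f @^-1` S n)) = (fun n => f @^-1` lspan (S n)).
  by apply/funext => n; exact: lspan_preimage.
by rewrite eW; split=> [|//|n _ [v Wv <-] //]; exact: grading_preimage.
Qed.

End Pullback.

Lemma filtered_lin_ext (F : DP -> V) :
  (forall d e, (F d)@_e != 0 -> (dsize e <= dsize d)%N) ->
  filtered (lin_ext F).
Proof.
move=> Fle n _ [v /QDPP vn <-]; apply: QDP_leP => e; rewrite mcoeff_lin_ext.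
apply: contraNT => en; apply/eqP; rewrite big_seq; apply: big1 => d.
rewrite -mcoeff_neq0 => /vn dn; have [->|/Fle] := eqVneq (F d)@_e 0.
  by rewrite mulr0.
by rewrite dn (negPf en).
Qed.

(** * Classes of morphisms lying between isomorphisms and epimorphisms *)

Section EpiClass.

Variable E : forall A B, dhom A B -> Prop.
Hypothesis iso_E : forall A B (f : dhom A B), is_iso f -> E f.
Hypothesis E_epi : forall A B (f : dhom A B), E f -> is_epi f.

Definition card_E (A B : dposet) : nat := #|[pred f : dhom A B | `[< E f >]]|.

Definition Phi_E (d : DP) : V :=
  \sum_(d' \in [set: DP])
    ((card_E (drep d) (drep d'))%:R / (card_Aut (drep d'))%:R) *: dvec d'.

Lemma card_E_gt0 A B : card_E A B != 0%N -> exists f : dhom A B, E f.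
Proof. by rewrite -lt0n => /card_gt0P[f]; rewrite inE; exists f. Qed.

Lemma mcoeff_Phi_E d e :
  (Phi_E d)@_e = (card_E (drep d) (drep e))%:R / (card_Aut (drep e))%:R.
Proof.
pose c e := (card_E (drep d) (drep e))%:R / (card_Aut (drep e))%:R : rat.
(* Epimorphisms do not increase size, so this finite set contains every class with a nonzero
   coefficient. *)
pose D := fset_set [set e | (dsize e <= dsize d)%N].
have c0 i : i \notin D -> c i = 0.
  rewrite /D in_fset_set; last exact: finite_dsize.
  move=> iD; rewrite /c; apply/eqP; rewrite mulf_eq0 pnatr_eq0.
  apply/orP; left; apply: contraNT iD => /card_E_gt0[f /E_epi/epi_card].
  by rewrite inE.
rewrite /Phi_E (fsbigTE D); last first.
  by move=> i /c0; rewrite /c => ->; rewrite scale0r.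
rewrite raddf_sum /=; under eq_bigr do rewrite mcoeffZ dvecE -/(c _).
have [eD|eD] := boolP (e \in D); last first.
  rewrite -/(c e) c0 // big_seq big1 // => i iD.
  by have [ie|] := eqVneq i e; rewrite ?mulr0 //; rewrite -ie iD in eD.
rewrite (big_fsetD1 e) //= eqxx mulr1 big_seq big1 ?addr0 // => i.
by rewrite in_fsetD1 => /andP[/negPf-> _]; rewrite mulr0.
Qed.

(** An epimorphic endomorphism has source and target of equal rank, hence is an automorphism; so the
    members of [E] from [drep d] to itself are exactly its automorphisms. *)
Lemma Phi_E_diag d : (Phi_E d)@_d = 1.
Proof.
rewrite mcoeff_Phi_E; suff -> : card_E (drep d) (drep d) = card_Aut (drep d).
  by rewrite divff // pnatr_eq0 -lt0n card_Aut_gt0.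
apply: eq_card => f; rewrite !inE; apply/asboolP/asboolP => [/E_epi ef|/iso_E//].
exact: epi_drank_iso.
Qed.

Lemma Phi_E_neq0 d e : (Phi_E d)@_e != 0 ->
  exists f : dhom (drep d) (drep e), E f.
Proof.
by rewrite mcoeff_Phi_E mulf_eq0 negb_or pnatr_eq0 => /andP[/card_E_gt0].
Qed.

Lemma Phi_E_tri d e : (Phi_E d)@_e != 0 ->
  e = d \/ (drank (drep e) < drank (drep d))%N.
Proof.
move=> /Phi_E_neq0[f /E_epi ef]; have := epi_drank ef.
rewrite leq_eqVlt => /orP[/eqP eR|]; last by right.
left; rewrite -(drepK d) -(drepK e); apply/dclassP/isomorphic_sym.
by exists f; exact: epi_drank_iso.
Qed.

Lemma Phi_E_theorem :
  [/\ linear_isomorphism (lin_ext Phi_E), filtered (lin_ext Phi_E)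
    & graded (fun n => lspan (lin_ext Phi_E @^-1` DPn n)) QDP (lin_ext Phi_E)].
Proof.
have iso := unitriangular_iso Phi_E_diag Phi_E_tri; split=> //.
  by apply: filtered_lin_ext => d e /Phi_E_neq0[f /E_epi/epi_card].
exact: (graded_preimage iso.2 QDP_grading).
Qed.

End EpiClass.

Theorem theorem3p2 :
  [/\ linear_isomorphism Phi_mono_mor,
      filtered Phi_mono_mor
    & graded (fun n => lspan (Phi_mono_mor @^-1` DPn n)) QDP Phi_mono_mor]
  /\
  [/\ linear_isomorphism Phi_regmono_mor,
      filtered Phi_regmono_mor
    & graded (fun n => lspan (Phi_regmono_mor @^-1` DPn n)) QDP
        Phi_regmono_mor].
Proof.
split.
  (* For [E] the regular epimorphisms, [lin_ext Phi_E] is [Phi_mono_mor] by unfolding; likewise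
     below for all epimorphisms. *)
  exact: (Phi_E_theorem iso_regepi regepi_epi).
exact: (Phi_E_theorem iso_epi (fun A B f (ef : is_epi f) => ef)).
Qed.
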